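(* (i) For $n\ge 3$, $\kappa(\mathcal{G}(D_n))=\delta(\mathcal{G}(D_n))$, where $D_n=\langle a,b\mid a^n=b^2=e,\ ab=ba^{-1}\rangle$ is the dihedral group of order $2n$. (ii) For $n\ge 2$, $\kappa(\mathcal{G}(Q_n))\ne\delta(\mathcal{G}(Q_n))$, where $Q_n=\langle a,b\mid a^{2n}=e,\ a^n=b^2,\ ab=ba^{-1}\rangle$ is the dicyclic group of order $4n$.
   Context: The power graph $\mathcal{G}(G)$ has vertex set $G$, distinct $u,v$ adjacent iff one is a positive integer power of the other. $\delta$ is minimum degree and $\kappa$ vertex connectivity (minimum number of vertices whose removal yields a disconnected or trivial graph). *)

(* Defs.v *)
From HB Require Import structures.
From mathcomp Require Import all_boot all_order all_fingroup all_algebra.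
From mathcomp Require Import cyclic extremal.

Set Implicit Arguments.
Unset Strict Implicit.
Unset Printing Implicit Defensive.

(* A finite simple graph is given by a vertex set V over an ambient finType   *)
(* and a symmetric irreflexive adjacency relation e, of which only the        *)
(* restriction to V matters.                                                  *)
Section SimpleGraphs.

Variables (T : finType) (V : {set T}) (e : rel T).

Definition degree (x : T) : nat := #|[set y in V | e x y]|.

(* The default #|V| is neutral when V is nonempty, as degrees are < #|V|.     *)
Definition min_degree : nat := \big[minn/#|V|]_(x in V) degree x.

Definition induced (W : {set T}) : rel T :=
  [rel x y | [&& x \in W, y \in W & e x y]].

Definition connected_on (W : {set T}) : bool :=
  [forall x in W, forall y in W, connect (induced W) x y].

Definition vertex_cut (S : {set T}) : bool :=
  [&& S \subset V & ~~ connected_on (V :\: S) || (#|V :\: S| == 1)].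

(* The default #|V| is neutral when V is nonempty, as removing all vertices   *)
(* but one leaves the trivial graph.                                          *)
Definition vertex_connectivity : nat :=
  \big[minn/#|V|]_(S : {set T} | vertex_cut S) #|S|.

End SimpleGraphs.

Section PowerGraph.

Local Open Scope group_scope.

Variable gT : finGroupType.
Implicit Types x y : gT.

(* Exponents up to #[x] exhaust all positive powers; see pos_powerP.          *)
Definition pos_power x y : bool := [exists m : 'I_#[x], y == x ^+ m.+1].

Lemma pos_powerP x y :
  reflect (exists2 m : nat, 0 < m & y = x ^+ m) (pos_power x y).
Proof.
apply: (iffP existsP) => [[m /eqP->] | [m m_gt0 ->]]; first by exists m.+1.
have lt_m: m.-1 %% #[x] < #[x] by rewrite ltn_mod order_gt0.
by exists (Ordinal lt_m); rewrite /= !expgS expg_mod_order -expgS prednK.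
Qed.

Definition power_graph : rel gT :=
  [rel x y | (x != y) && (pos_power x y || pos_power y x)].

End PowerGraph.

Arguments power_graph : clear implicits.

Section Presentations.

Local Open Scope group_scope.

Definition is_dihedral (n : nat) (gT : finGroupType) (G : {group gT}) : Prop :=
  G \isog Grp (a : b : a ^+ n, b ^+ 2, a * b = b * a^-1).

Definition is_dicyclic (n : nat) (gT : finGroupType) (G : {group gT}) : Prop :=
  G \isog Grp (a : b : a ^+ (2 * n), a ^+ n = b ^+ 2, a * b = b * a^-1).

End Presentations.

(* Models of the two presentations, of the expected orders 2n and 4n.         *)

Lemma dihedral_model n : 1 < n ->
  is_dihedral n [set: 'D_(2 * n)]%G /\ #|[set: 'D_(2 * n)]| = 2 * n.
Proof.
move=> n_gt1; rewrite mul2n; split; last exact: card_dihedral.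
move=> rT H; rewrite (Grp_dihedral n_gt1).
apply: eq_existsb => [[x y]] /=; rewrite !xpair_eqE /=.
congr [&& _, _, _ & _]; rewrite conjgE.
exact: (can2_eq (mulKVg y) (mulKg y)).
Qed.

Definition dicyclic_type (n : nat) : Type := ('Z_(2 * n) * bool)%type.

Section DicyclicModel.

Import GRing.Theory.
Local Open Scope ring_scope.

Variable n : nat.
Local Notation Q := (dicyclic_type n).

HB.instance Definition _ := Finite.on Q.

(* (i, s) stands for a ^ i * b ^ s.                                           *)
Definition dicyclic_mul (u v : Q) : Q :=
  (u.1 + (-1) ^+ u.2 * v.1 + n%:R *+ (u.2 && v.2), u.2 (+) v.2).
Definition dicyclic_one : Q := (0, false).
Definition dicyclic_inv (u : Q) : Q :=
  (if u.2 then u.1 + n%:R else - u.1, u.2).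

Lemma dicyclic_nn : n%:R + n%:R = 0 :> 'Z_(2 * n).
Proof.
case: n => [|m]; first by rewrite addr0.
rewrite -natrD addnn -mul2n; apply: val_inj.
by rewrite /= val_Zp_nat ?modnn // mulnS.
Qed.

Lemma dicyclic_2n : (2 * n)%:R = 0 :> 'Z_(2 * n).
Proof. by rewrite natrM mulr_natl mulr2n dicyclic_nn. Qed.

Lemma dicyclic_opp_n : - n%:R = n%:R :> 'Z_(2 * n).
Proof. by apply/eqP; rewrite eq_sym -addr_eq0 dicyclic_nn. Qed.

Lemma dicyclic_mulA : associative dicyclic_mul.
Proof.
move=> [i []] [j []] [k []]; rewrite /dicyclic_mul /=;
  rewrite ?expr0 ?expr1 ?mul1r ?mulN1r ?mulr0n ?mulr1n ?addr0 ?opprD ?opprK //;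
  rewrite ?dicyclic_opp_n ?addrA //.
all: by congr (_, _); apply: addrAC.
Qed.

Lemma dicyclic_mul1 : left_id dicyclic_one dicyclic_mul.
Proof. by move=> [i s]; rewrite /dicyclic_mul /= mul1r add0r addr0. Qed.

Lemma dicyclic_mulV : left_inverse dicyclic_one dicyclic_inv dicyclic_mul.
Proof.
move=> [i []]; rewrite /dicyclic_mul /= ?mul1r ?mulN1r ?mulr1n ?mulr0n.
  by rewrite (addrAC i) subrr add0r dicyclic_nn.
by rewrite addr0 addNr.
Qed.

HB.instance Definition _ := Finite_isGroup.Build Q
  dicyclic_mulA dicyclic_mul1 dicyclic_mulV.

Lemma card_dicyclic_model : (0 < n)%N -> #|[set: Q]| = (4 * n)%N.
Proof.
move=> n_gt0; have o_gt1: (1 < 2 * n)%N.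
  by rewrite mul2n -addnn -(prednK n_gt0) addnS.
by rewrite cardsT card_prod card_bool card_ord (Zp_cast o_gt1) mulnAC.
Qed.

Local Open Scope group_scope.

Lemma dicyclic_mulE (u v : Q) : u * v = dicyclic_mul u v.
Proof. by []. Qed.

Lemma dicyclic_a (k : nat) :
  ((1%R, false) : Q) ^+ k = ((k%:R)%R, false) :> Q.
Proof.
elim: k => [|k IHk]; first by rewrite expg0.
rewrite expgS IHk dicyclic_mulE /dicyclic_mul.
by rewrite /= mul1r addr0 mulrS.
Qed.

Lemma dicyclic_model : (0 < n)%N -> is_dicyclic n [set: Q]%G.
Proof.
move=> n_gt0; have o_gt1: (1 < 2 * n)%N.
  by rewrite mul2n -addnn -(prednK n_gt0) addnS.
have def_o := Zp_cast o_gt1.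
apply: intro_isoGrp => [|rT H].
  pose a : Q := (1%R, false); pose b : Q := (0%R, true).
  have a2n : a ^+ (2 * n) = 1 by rewrite dicyclic_a dicyclic_2n.
  have an : a ^+ n = b ^+ 2.
    rewrite dicyclic_a expgS expg1 dicyclic_mulE /dicyclic_mul /=.
    by rewrite mulr0 !add0r.
  have ab : a * b = b * a^-1.
    rewrite !dicyclic_mulE /dicyclic_mul /= mulr0 !addr0 add0r.
    by rewrite mulN1r opprK.
  have defQ : <[a]> <*> <[b]> = [set: Q].
    apply/eqP; rewrite eqEsubset subsetT; apply/subsetP => -[i s] _.
    have ->: (i, s) = a ^+ i * b ^+ s.
      rewrite dicyclic_a natr_Zp; case: s; last by rewrite mulg1.
      by rewrite dicyclic_mulE /dicyclic_mul /= mulr0 !addr0.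
    by rewrite groupM // groupX // mem_gen // inE cycle_id ?orbT.
  by apply/existsP; exists (a, b); apply/eqP; rewrite /= defQ a2n an ab.
case/existsP => -[x y] /= /eqP[defH x2n xn xy].
have xX (k : nat) : x ^+ (k %% (Zp_trunc (2 * n)).+2) = x ^+ k.
  by rewrite def_o expg_mod.
have xD (i j : 'Z_(2 * n)) : x ^+ (i + j)%R = x ^+ i * x ^+ j.
  by rewrite -expgD -[RHS]xX.
have xN (i : 'Z_(2 * n)) : x ^+ (- i)%R = (x ^+ i)^-1.
  by apply/eqP; rewrite eq_sym eq_invg_mul -xD subrr.
have xn' : x ^+ (n%:R : 'Z_(2 * n))%R = x ^+ n.
  by rewrite (val_Zp_nat o_gt1) expg_mod.
have yx (k : nat) : y * x ^+ k = (x ^+ k)^-1 * y.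
  have xJ : x ^ y = x^-1 by rewrite conjgE xy mulKg.
  by rewrite [RHS]conjgC conjVg conjXg xJ expgVn invgK.
pose f (u : Q) := x ^+ u.1 * y ^+ u.2.
have fE i s : f (i, s) = x ^+ i * y ^+ s by [].
have fM : {in [set: Q] &, {morph f : u v / u * v}}.
  move=> [i [|]] [j t] _ _; rewrite dicyclic_mulE /dicyclic_mul !fE; last first.
    by rewrite mul1r addr0 xD mulg1 mulgA.
  rewrite mulN1r expg1 -[RHS]mulgA (mulgA y) yx -mulgA.
  case: t; last by rewrite mulr0n addr0 xD xN !mulgA mulg1.
  by rewrite mulr1n !xD xN xn' xn expg0 mulg1 !mulgA.
apply/homgP; exists (Morphism fM); apply/eqP.
rewrite morphimEdom eqEsubset -defH join_subG !cycle_subG.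
apply/and3P; split.
- apply/subsetP => _ /imsetP[[i s] _ ->].
  by rewrite groupM // groupX // mem_gen // inE cycle_id ?orbT.
- by apply/imsetP; exists (1%R, false); rewrite ?inE //= /f /= mulg1.
- by apply/imsetP; exists (0%R, true); rewrite ?inE //= /f /= mul1g.
Qed.

End DicyclicModel.

(* Main.v *)
Require Import Defs.
From mathcomp Require Import all_boot all_order all_fingroup.
From mathcomp Require Import cyclic.

(** Let [A = <[a]>], a subgroup of index 2. All elements outside [A] have the
    same square [b ^+ 2]. In the dihedral case they are involutions, so each is
    adjacent to the identity only, and [{1}] is a cut: both invariants are 1.
    In the dicyclic case they have order 4, so [b] is adjacent exactly to [1],
    [b ^+ 2] and [b^-1]; removing [1] and [b ^+ 2] isolates [{b, b^-1}], whence
    connectivity at most 2. Every degree is however at least 3, since every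
    element of [A] other than [1], [a], [a^-1] is adjacent to these three, while
    the remaining [g != 1] are adjacent to [1], [g^-1] and [g ^+ 2]. *)

Set Implicit Arguments.
Unset Strict Implicit.
Unset Printing Implicit Defensive.

(** * Bounds on degree and connectivity in a finite graph *)

Section Graph.

Variables (T : finType) (V : {set T}) (e : rel T).

Lemma bigminn_le (I : finType) (P : pred I) (F : I -> nat) m i :
  P i -> \big[minn/m]_(j | P j) F j <= F i.
Proof.
move=> Pi; have := mem_index_enum i.
elim: (index_enum I) => // j r IHr; rewrite inE big_cons => /predU1P[<-|/IHr].
  by rewrite Pi geq_minl.
by case: ifP => // _; apply: leq_trans; apply: geq_minr.
Qed.

Lemma leq_bigminn (I : finType) (P : pred I) (F : I -> nat) m k :
  k <= m -> (forall i, P i -> k <= F i) -> k <= \big[minn/m]_(j | P j) F j.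
Proof.
by move=> lekm leF; elim/big_ind: _ => // x y; rewrite leq_min => -> ->.
Qed.

Lemma leq_degree x s :
  uniq s -> {subset s <= V} -> all (e x) s -> size s <= degree V e x.
Proof.
move=> /card_uniqP <- sV /allP sx; apply/subset_leq_card/subsetP => y ys.
by rewrite inE sV ?sx.
Qed.

Lemma connect_invariant (W : {set T}) (P : pred T) x y :
    (forall u v, u \in W -> v \in W -> e u v -> P u -> P v) ->
  connect (induced e W) x y -> P x -> P y.
Proof.
move=> closedP /connectP[p]; elim: p x => [|z p IHp] x /= => [_ -> //|].
by case/andP=> /and3P[xW zW xz] /IHp IH /IH{}IH /(closedP x z xW zW xz).
Qed.

(** A predicate closed under adjacency off [S] is a union of components there, so no path leads from
    [x] to [y]. *)
Lemma connectivity_le_cut (S : {set T}) (P : pred T) x y :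
    S \subset V -> x \in V :\: S -> y \in V :\: S -> P x -> ~~ P y ->
    (forall u v, u \in V :\: S -> v \in V :\: S -> e u v -> P u -> P v) ->
  vertex_connectivity V e <= #|S|.
Proof.
move=> sSV xW yW Px nPy closedP; apply: bigminn_le.
rewrite /vertex_cut sSV; apply/orP; left; apply/negP => /forall_inP/(_ x xW).
by move=> /forall_inP/(_ y yW) /(connect_invariant closedP) /(_ Px); apply/negP.
Qed.

(** Any two vertices are joined through [c], so the empty set is no cut; [1 < #|V|] rules out the
    trivial graph. *)
Lemma connectivity_gt0 c :
    c \in V -> 1 < #|V| ->
    (forall x, x \in V -> x != c -> e c x && e x c) ->
  0 < vertex_connectivity V e.
Proof.
move=> cV V_gt1 joinc; apply: leq_bigminn => [|S /andP[_ cutS]]; first exact: ltnW.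
rewrite lt0n cards_eq0; apply: contraL cutS => /eqP ->.
rewrite setD0 negb_or negbK gtn_eqF // andbT.
apply/forall_inP=> x xV; apply/forall_inP=> y yV.
apply: (@connect_trans _ _ c).
  have [-> //|x'c] := eqVneq x c; apply: connect1; rewrite /induced /= xV cV.
  by case/andP: (joinc x xV x'c).
have [-> //|y'c] := eqVneq y c; apply: connect1; rewrite /induced /= cV yV.
by case/andP: (joinc y yV y'c).
Qed.

End Graph.

Local Open Scope group_scope.

(** * Adjacency in the power graph through cyclic subgroups *)

Section PowerGraph.

Variable gT : finGroupType.
Implicit Types (x y a b : gT) (G : {group gT}).

(** Adding [#[x]] to an exponent makes it positive without changing the power. *)
Lemma pos_power_cycle x y : pos_power x y = (y \in <[x]>).
Proof.
apply/pos_powerP/cycleP => [[m _ ->]|[m ->]]; first by exists m.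
by exists (m + #[x])%N; rewrite ?addn_gt0 ?order_gt0 ?orbT // expgD expg_order mulg1.
Qed.

Lemma power_graphE x y :
  power_graph gT x y = (x != y) && ((y \in <[x]>) || (x \in <[y]>)).
Proof. by rewrite /power_graph /= !pos_power_cycle. Qed.

Lemma power_graph1 x : x != 1 -> power_graph gT 1 x && power_graph gT x 1.
Proof. by move=> x'1; rewrite !power_graphE !group1 orbT eq_sym x'1. Qed.

(** Each group is a homomorphic image of the other. This transfers the orders of the explicit models
    to [G]. *)
Lemma isoGrp_card rT G (H : {group rT}) p :
  G \isog Grp p -> H \isog Grp p -> #|G| = #|H|.
Proof.
move=> isoG isoH; apply/eqP; rewrite eqn_leq !leq_homg //.
  by rewrite isoG; apply: isoGrp_hom.
by rewrite isoH; apply: isoGrp_hom.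
Qed.

(** * Common ground of both presentations: [m] is [n] in the dihedral case, [2 * n] in the dicyclic
    one *)

Section IndexTwo.

Variables (G : {group gT}) (a b : gT) (m : nat).
Hypotheses (defG : <[a]> <*> <[b]> = G) (ab : a * b = b * a^-1).
Hypotheses (am : a ^+ m = 1) (b2 : b ^+ 2 \in <[a]>) (oG : #|G| = (2 * m)%N).
Hypothesis m_gt0 : 0 < m.

Lemma conj_cycle_inv x : x \in <[a]> -> x ^ b = x^-1.
Proof.
have aJ : a ^ b = a^-1 by rewrite conjgE ab mulKg.
by case/cycleP=> k ->; rewrite conjXg aJ expgVn.
Qed.

(** Since [b] normalizes [<[a]>], every element is some [x * b ^+ k] with [x] in [<[a]>], and the
    even part of [b ^+ k] is absorbed into [<[a]>]. *)
Lemma index2_coset y :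
  y \in G -> y \notin <[a]> -> exists2 x, x \in <[a]> & y = x * b.
Proof.
have nab : <[b]> \subset 'N(<[a]>).
  rewrite cycle_subG; apply/normP; rewrite -genJ conjg_set1.
  by rewrite conj_cycle_inv ?cycle_id // -/<[a^-1]> cycleV.
rewrite -defG norm_joinEr // => /mulsgP[x _ xa /cycleP[k ->] ->].
rewrite -(odd_double_half k) addnC expgD -mul2n expgM mulgA.
have xa' : x * (b ^+ 2) ^+ k./2 \in <[a]> by rewrite groupM // groupX.
case: (odd k); last by rewrite mulg1 xa'.
by exists (x * (b ^+ 2) ^+ k./2).
Qed.

(** Two cosets of [<[a]>] cover [G], which has order [2 * m], so [#[a]] is at least [m]. *)
Lemma order_index2 : #[a] = m.
Proof.
have le_am : #[a] <= m by rewrite dvdn_leq // order_dvdn am.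
have sG : G \subset <[a]> :|: <[a]> :* b.
  apply/subsetP => y yG; rewrite inE.
  have [//|/(index2_coset yG)[x xa ->]] := boolP (y \in _).
  by rewrite mem_rcoset mulgK.
apply/eqP; rewrite eqn_leq le_am -(@leq_pmul2l 2) // -oG mul2n -addnn.
apply: leq_trans (subset_leq_card sG) _.
by apply: leq_trans (leq_card_setU _ _) _; rewrite card_rcoset.
Qed.

Lemma generator_notin_index2 : b \notin <[a]>.
Proof.
apply: contraTN isT => ba; have : #|G| <= #|<[a]>|.
  by rewrite subset_leq_card // -defG join_subG subxx cycle_subG.
by rewrite -/#[a] order_index2 oG leqNgt ltn_Pmull.
Qed.

(** Moving [b] past [x] inverts [x], so the square of [x * b] is [x * b ^+ 2 * x^-1], and [b ^+ 2]
    commutes with [x]. *)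
Lemma sqr_notin_index2 y : y \in G -> y \notin <[a]> -> y ^+ 2 = b ^+ 2.
Proof.
move=> yG /(index2_coset yG)[x xa ->].
have cxb : commute x (b ^+ 2).
  by have /centP := subsetP (cycle_abelian a) _ xa; apply.
rewrite expgS expg1 {2}(conjgC x b) conj_cycle_inv // mulgA -(mulgA x).
by rewrite -[b * b]/(b ^+ 2) cxb mulgK.
Qed.

End IndexTwo.

(** * The dihedral case *)

Lemma dihedral_connectivity n G : 3 <= n -> is_dihedral n G ->
  vertex_connectivity G (power_graph gT) = min_degree G (power_graph gT).
Proof.
move=> n_gt2 isoG; have n_gt1 := ltnW n_gt2; have n_gt0 := ltnW n_gt1.
have [isoD oD] := dihedral_model n_gt1.
have oG : #|G| = (2 * n)%N by rewrite (isoGrp_card isoG isoD).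
have /existsP[[a b] /= /eqP[defG an b2 ab]] := isoGrp_hom isoG.
have b2a : b ^+ 2 \in <[a]> by rewrite b2 group1.
have aG : a \in G by rewrite -defG mem_gen // inE cycle_id.
have bG : b \in G by rewrite -defG mem_gen // inE cycle_id orbT.
have oa := order_index2 defG ab an b2a oG n_gt0.
have bA := generator_notin_index2 defG ab an b2a oG n_gt0.
have sqrA := sqr_notin_index2 defG ab b2a.
have b1 : b != 1 by apply: contraNneq bA => ->; apply: group1.
have a1 : a != 1 by rewrite -order_eq1 oa gtn_eqF.
have cyc2 y z : y ^+ 2 = 1 -> z \in <[y]> -> z = 1 \/ z = y.
  move=> y2 /cycleP[k ->]; rewrite -(odd_double_half k) -mul2n expgD expgM y2.
  by rewrite expg1n mulg1; case: (odd k); [right | left].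
(* If instead [b] is a power of [z], then [z] lies outside [<[a]>], so it is an involution too and
   [b] is [1] or [z]. *)
have nbr_b z : z \in G -> power_graph gT b z -> z = 1.
  move=> zG; rewrite power_graphE => /andP[b'z /orP[/(cyc2 _ _ b2)[] // zb | bz]].
    by rewrite zb eqxx in b'z.
  have zA : z \notin <[a]> by apply: contra bA; rewrite -cycle_subG => /subsetP->.
  have [eb|eb] := cyc2 z b (etrans (sqrA z zG zA) b2) bz.
    by rewrite eb eqxx in b1.
  by rewrite eb eqxx in b'z.
have G_gt1 : 1 < #|G| by rewrite oG -(muln1 2) leq_mul.
have ->: min_degree G (power_graph gT) = 1%N.
  apply/eqP; rewrite eqn_leq; apply/andP; split.
    apply: leq_trans (bigminn_le _ _ bG) _; rewrite -(cards1 (1 : gT)).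
    apply/subset_leq_card/subsetP => z; rewrite !inE => /andP[zG bz].
    by apply/eqP/nbr_b.
  apply: leq_bigminn => [|x xG]; first exact: ltnW.
  have [-> | x1] := eqVneq x 1.
    apply: (@leq_degree _ _ _ _ [:: a]) => [//|z|/=].
      by rewrite inE => /eqP->.
    by case/andP: (power_graph1 a1) => ->.
  apply: (@leq_degree _ _ _ _ [:: 1]) => [//|z|/=].
    by rewrite inE => /eqP->.
  by case/andP: (power_graph1 x1) => _ ->.
apply/eqP; rewrite eqn_leq; apply/andP; split; last first.
  by apply: (@connectivity_gt0 _ _ _ 1) => // x _; apply: power_graph1.
rewrite -(cards1 (1 : gT)).
apply: (@connectivity_le_cut _ _ _ _ (pred1 b) b a);
  rewrite ?sub1set ?inE ?eqxx ?a1 ?b1 //.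
  by apply: contraNneq bA => <-; apply: cycle_id.
move=> u v _; rewrite !inE => /andP[v1 vG] uv /eqP Eu.
by rewrite Eu in uv; rewrite (nbr_b v vG uv) eqxx in v1.
Qed.

(** * The dicyclic case *)

Lemma degree_ge3 G g : g \in G -> g ^+ 2 != 1 -> g ^+ 3 != 1 ->
  3 <= degree G (power_graph gT) g.
Proof.
move=> gG g2 g3; have g1 : g != 1.
  by apply: contraNneq g2 => ->; rewrite expg1n.
(* [g ^+ 2 != 1] separates [g] from [g^-1], and [g ^+ 3 != 1] separates [g^-1] from [g ^+ 2]. *)
apply: (@leq_degree _ _ _ _ [:: 1; g^-1; g ^+ 2]) => [|z|].
- rewrite /= !inE !negb_or andbT eq_sym invg_eq1 g1 eq_sym g2 /=.
  by rewrite eq_invg_mul -expgS.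
- by rewrite !inE => /or3P[] /eqP->; rewrite ?group1 ?groupV ?groupX.
- rewrite /= !power_graphE !group1 groupV groupX ?cycle_id // !andbT g1 /=.
  rewrite eq_sym eq_invg_mul -[g * g]/(g ^+ 2) g2 /=.
  by rewrite expgS expg1 -{1}(mulg1 g) (inj_eq (mulgI g)) eq_sym.
Qed.

Lemma dicyclic_connectivity_lt n G : 2 <= n -> is_dicyclic n G ->
  vertex_connectivity G (power_graph gT) < min_degree G (power_graph gT).
Proof.
move=> n_gt1 isoG; have n_gt0 := ltnW n_gt1.
have oG : #|G| = (2 * (2 * n))%N.
  by rewrite (isoGrp_card isoG (dicyclic_model n_gt0)) card_dicyclic_model ?mulnA.
have /existsP[[a b] /= /eqP[defG a2n an ab]] := isoGrp_hom isoG.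
have b2a : b ^+ 2 \in <[a]> by rewrite -an mem_cycle.
have n2_gt0 : 0 < 2 * n by rewrite muln_gt0.
have aG : a \in G by rewrite -defG mem_gen // inE cycle_id.
have bG : b \in G by rewrite -defG mem_gen // inE cycle_id orbT.
have oa := order_index2 defG ab a2n b2a oG n2_gt0.
have bA := generator_notin_index2 defG ab a2n b2a oG n2_gt0.
have sqrA := sqr_notin_index2 defG ab b2a.
have aX k : 0 < k < 2 * n -> a ^+ k != 1.
  by case/andP=> k_gt0 k_lt; rewrite -order_dvdn oa gtnNdvd.
have n2_gt3 : 3 < 2 * n by rewrite (@leq_mul 2 2).
have a1 : a != 1 by rewrite (aX 1%N) //= (leq_trans _ n2_gt3).
have a2 : a ^+ 2 != 1 by rewrite aX //= (leq_trans _ n2_gt3).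
have a3 : a ^+ 3 != 1 by rewrite aX.
have z1 : b ^+ 2 != 1 by rewrite -an aX // n_gt0 ltn_Pmull.
have zz : (b ^+ 2) ^+ 2 = 1 by rewrite -an -expgM mulnC.
have az : a != b ^+ 2.
  rewrite -an -{1}(expg1 a) eq_expg_mod_order oa !modn_small ?ltn_Pmull //.
    by rewrite ltn_eqF.
  exact: leq_trans n2_gt3.
(* Here [y ^+ 4 = 1], so only the last two binary digits of the exponent matter. *)
have cyc4 y v : y ^+ 2 = b ^+ 2 -> v \in <[y]> -> v \in [:: 1; b ^+ 2; y; y^-1].
  move=> y2 /cycleP[k ->]; rewrite -(odd_double_half k) -mul2n expgD expgM y2.
  have yV : y * b ^+ 2 = y^-1.
    apply/eqP; rewrite eq_sym eq_invg_mul mulgA -[y * y]/(y ^+ 2) y2.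
    by rewrite -[_ * _]/((b ^+ 2) ^+ 2) zz.
  rewrite -(odd_double_half k./2) -mul2n (expgD (b ^+ 2)) (expgM (b ^+ 2)).
  rewrite zz expg1n mulg1.
  by case: (odd k); case: (odd k./2);
    rewrite ?mulg1 ?mul1g ?expg1 ?yV !inE eqxx ?orbT.
(* If [y] is a power of [v], then [v] is also outside [<[a]>], and [cyc4] applies to [v]; as [1] and
   [b ^+ 2] lie in [<[a]>], only [y = v^-1] remains. *)
have nbr y v : y \in G -> y \notin <[a]> -> v \in G -> power_graph gT y v ->
    v \in [:: 1; b ^+ 2; y^-1].
  move=> yG yA vG; rewrite power_graphE => /andP[y'v /orP[yv | vy]].
    by have := cyc4 _ _ (sqrA y yG yA) yv; rewrite !inE (eq_sym v y) (negPf y'v).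
  have vA : v \notin <[a]> by apply: contra yA; rewrite -cycle_subG => /subsetP->.
  have := cyc4 _ _ (sqrA v vG vA) vy; rewrite !inE (negPf y'v).
  case/or4P=> [/eqP Ey|/eqP Ey|//|/eqP->].
  - by rewrite Ey group1 in yA.
  - by rewrite Ey b2a in yA.
  - by rewrite invgK eqxx !orbT.
apply: (@leq_trans 3).
  rewrite ltnS; apply: (@leq_trans #|[set 1; b ^+ 2]|); last first.
    by rewrite cards2; case: (_ != _).
  have b1 : b != 1 by apply: contraNneq bA => ->; apply: group1.
  have bz : b != b ^+ 2 by apply: contraNneq bA => {1}->.
  apply: (@connectivity_le_cut _ _ _ _ (mem [:: b; b^-1]) b a).
  - by apply/subsetP => u; rewrite !inE => /orP[] /eqP->; rewrite ?group1 ?groupX.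
  - by rewrite !inE bG negb_or b1 bz.
  - by rewrite !inE aG negb_or a1 az.
  - by rewrite !inE eqxx.
  - rewrite !inE negb_or; apply/andP; split; apply: contraNneq bA => ab'.
      by rewrite -ab' cycle_id.
    by rewrite -groupV -ab' cycle_id.
  - move=> u v _; rewrite !inE negb_or => /andP[/andP[v1 vz] vG] uv.
    case/orP=> /eqP Eu; rewrite Eu in uv.
      by have := nbr b v bG bA vG uv; rewrite !inE (negPf v1) (negPf vz) /= orbC => ->.
    have := nbr b^-1 v _ _ vG uv; rewrite !groupV !inE (negPf v1) (negPf vz) invgK /=.
    by move=> -> //.
(* The default value [#|G|] of the minimum must be at least 3 as well. *)
apply: leq_bigminn => [|x xG]; first by rewrite oG (leq_trans (ltnW n2_gt3)) // leq_pmull.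
have aV : a != a^-1 by rewrite eq_sym eq_invg_mul.
have [-> | x1] := eqVneq x 1.
  (* The identity is adjacent to everything else; three distinct elements suffice. *)
  apply: (@leq_degree _ _ _ _ [:: a; a^-1; b]) => [|v|].
  - rewrite /= !inE negb_or aV /= andbT; apply/andP; split; apply: contraNneq bA => <-.
      exact: cycle_id.
    by rewrite groupV cycle_id.
  - by rewrite !inE => /or3P[] /eqP->; rewrite ?groupV.
  - rewrite /= !power_graphE !group1 !orbT !andbT !(eq_sym 1) invg_eq1 a1 /=.
    by apply: contraNneq bA => ->; apply: group1.
have [xA | xA] := boolP (x \in <[a]>); last first.
  (* As [x ^+ 3 = b ^+ 2 * x], a trivial cube would put [x] in [<[a]>]. *)
  apply: degree_ge3 => //; rewrite ?(expgSr x 2) (sqrA x xG xA) //.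
  by apply: contraNneq xA => /eqP; rewrite -eq_invg_mul => /eqP<-; rewrite groupV.
have [-> | xa] := eqVneq x a; first exact: degree_ge3.
have [-> | xaV] := eqVneq x a^-1.
  by apply: degree_ge3; rewrite ?groupV // expgVn invg_eq1.
(* [x] is a power of both generators [a] and [a^-1] of [<[a]>]. *)
apply: (@leq_degree _ _ _ _ [:: 1; a; a^-1]) => [|v|].
- by rewrite /= !inE negb_or aV eq_sym a1 eq_sym invg_eq1 a1.
- by rewrite !inE => /or3P[] /eqP->; rewrite ?groupV ?group1.
- by rewrite /= !power_graphE group1 x1 xa xaV cycleV xA !orbT.
Qed.

End PowerGraph.

Theorem theorem6p9 :
  (forall (n : nat) (gT : finGroupType) (G : {group gT}),
      3 <= n -> is_dihedral n G ->
      vertex_connectivity G (power_graph gT) = min_degree G (power_graph gT))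
  /\
  (forall (n : nat) (gT : finGroupType) (G : {group gT}),
      2 <= n -> is_dicyclic n G ->
      vertex_connectivity G (power_graph gT) <> min_degree G (power_graph gT)).
Proof.
split=> n gT G n_ge isoG; first exact: dihedral_connectivity n_ge isoG.
by have := dicyclic_connectivity_lt n_ge isoG; rewrite ltn_neqAle => /andP[/eqP].
Qed.
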